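(* Given a finite set of distinct positive real numbers, the following ordering yields the maximum voucher cost among all orderings of the set. First, all the numbers in the set that are greater than or equal to $1$ (say there are $m$ of them) are arranged to be order-isomorphic to \[2,\ 4,\ 6,\ 8,\ \ldots,\ m,\ \ldots,\ 7,\ 5,\ 3,\ 1\] (all even numbers in $\{1,\dots,m\}$ in increasing order followed by all odd numbers in $\{1,\dots,m\}$ in decreasing order), and then all the numbers in the set that are less than $1$ are placed at the end in decreasing order.
   Context: The voucher cost of a sequence $\vec v=(v_1,\dots,v_n)$ is $C_V(\vec v)=v_1+v_1v_2+v_2v_3+\cdots+v_{n-1}v_n$. A sequence $\vec v$ of $m$ distinct reals is order-isomorphic to a permutation $(p_1,\dots,p_m)$ of $\{1,\dots,m\}$ if $p_i<p_j\iff v_i<v_j$ for all $i,j$. *)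

(* Defs.v *)
From HB Require Import structures.
From mathcomp Require Import all_boot all_order all_algebra.
From mathcomp Require Import finmap.
From mathcomp Require Import reals.

Set Implicit Arguments.
Unset Strict Implicit.
Unset Printing Implicit Defensive.

Import Order.TTheory GRing.Theory Num.Theory.

Local Open Scope fset_scope.
Local Open Scope ring_scope.

(* The mathematical indices 1, ..., n become 0, ..., n - 1. The cost of the
   empty sequence is 0, because nth defaults to 0. *)
Definition voucher_cost (R : realType) (v : seq R) : R :=
  v`_0 + \sum_(i < (size v).-1) v`_i * v`_i.+1.

Definition ordering_of (R : realType) (A : {fset R}) (v : seq R) : Prop :=
  uniq v /\ v =i A.

Definition order_isomorphic (R : realType) (v : seq R) (p : seq nat) : Prop :=
  size v = size p /\
  forall i j : nat, (i < size v)%N -> (j < size v)%N ->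
    (nth 0%N p i < nth 0%N p j)%N = (v`_i < v`_j).

(* The word 2, 4, 6, ..., 5, 3, 1 on {1, ..., m}, for m of either parity. *)
Definition even_up_odd_down (m : nat) : seq nat :=
  [seq k <- iota 1 m | ~~ odd k] ++ rev [seq k <- iota 1 m | odd k].

Definition prescribed_ordering (R : realType) (A : {fset R}) (w : seq R) :
    Prop :=
  let big := [fset x in A | 1 <= x] in
  let small := [fset x in A | x < 1] in
  exists w1 w2 : seq R,
    [/\ w = w1 ++ w2,
        ordering_of big w1,
        order_isomorphic w1 (even_up_odd_down #|` big|),
        ordering_of small w2
      & sorted >%R w2].

Definition max_voucher_ordering (R : realType) (A : {fset R}) (w : seq R) :
    Prop :=
  ordering_of A w /\
  forall v : seq R, ordering_of A v -> voucher_cost v <= voucher_cost w.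

(* Main.v *)
(** Put a phantom 1 before the sequence and a phantom 0 after it: the voucher
    cost becomes the sum of products of neighbours along the path
    1, v_1, ..., v_n, 0. For a path segment with fixed end values L and R,
    reversing the block x_i ... x_j inside it changes the sum by
    (x_(i-1) - x_(j+1)) (x_j - x_i). Hence, if R <= L and R is below all interior
    values, moving the interior minimum next to R by such a reversal does not
    decrease the sum, and symmetrically for L. Repeating this on the shrinking
    interior first places the numbers below 1 at the right end, where the right
    end value stays below L = 1, and then the numbers at least 1 alternately at
    the right and at the left. *)

Require Import Defs.
From HB Require Import structures.
From mathcomp Require Import all_boot all_order all_algebra.
From mathcomp Require Import finmap.
From mathcomp Require Import reals lra.

Set Implicit Arguments.
Unset Strict Implicit.
Unset Printing Implicit Defensive.

Import Order.TTheory GRing.Theory Num.Theory.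

Local Open Scope fset_scope.
Local Open Scope ring_scope.

Lemma seq_pair_ind (T : Type) (P : seq T -> Prop) :
    P [::] -> (forall x, P [:: x]) ->
    (forall x y s, P s -> P [:: x, y & s]) ->
  forall s, P s.
Proof.
move=> P0 P1 P2 s; suff: P s /\ forall x, P (x :: s) by case.
by elim: s => [|x s [Ps Pxs]]; split=> // y; apply: P2.
Qed.

(** * Optimal arrangements between fixed end values *)

Section PathCost.
Variable R : realType.
Implicit Types (x y a b q : R) (s t v : seq R).

Fixpoint path_cost x s : R :=
  if s is y :: s' then x * y + path_cost y s' else 0.

Lemma path_cost_cat x s t :
  path_cost x (s ++ t) = path_cost x s + path_cost (last x s) t.
Proof. by elim: s x => [|y s IH] x /=; rewrite ?add0r // IH addrA. Qed.

Lemma path_cost_rcons x s y :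
  path_cost x (rcons s y) = path_cost x s + last x s * y.
Proof. by rewrite -cats1 path_cost_cat /= addr0. Qed.

Lemma path_cost_rev x s y :
  path_cost x (rcons s y) = path_cost y (rcons (rev s) x).
Proof.
elim: s x => [|z s IH] x /=; first by rewrite mulrC.
by rewrite IH rev_cons [RHS]path_cost_rcons last_rcons addrC (mulrC x).
Qed.

Lemma voucher_cost_path v : voucher_cost v = path_cost 1 (rcons v 0).
Proof.
rewrite path_cost_rcons mulr0 addr0 /voucher_cost.
case: v => [|x s] /=; first by rewrite big_ord0 addr0.
rewrite mul1r; congr (_ + _).
elim: s x => [|y s IH] x /=; first by rewrite big_ord0.
by rewrite big_ord_recl /= -IH.
Qed.

Lemma min_to_right a b q t v :
    perm_eq v (q :: t) -> b <= a -> {in t, forall x, b <= x} ->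
    {in t, forall x, q <= x} ->
  exists2 u, perm_eq u t &
    path_cost a (rcons v b) <= path_cost a (rcons (rcons u q) b).
Proof.
move=> vqt ba bt qt.
have /splitPr vE : q \in v by rewrite (perm_mem vqt) mem_head.
case: vE vqt => v1 v2 vqt.
have {vqt} v12t : perm_eq (v1 ++ v2) t.
  by rewrite -(perm_cons q) -(permPr vqt) -(cat1s q v2) perm_sym perm_catCA.
(* Reversing the block [q :: v2] brings [q] next to [b]. *)
exists (v1 ++ rev v2).
  by rewrite -(permPr v12t) perm_cat2l perm_rev.
have b_last : b <= last a v1.
  have := mem_last a v1; rewrite inE => /predU1P[-> // | lv1].
  by apply: bt; rewrite -(perm_mem v12t) mem_cat lv1.
have q_last : q <= last q v2.
  have := mem_last q v2; rewrite inE => /predU1P[-> // | lv2].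
  by apply: qt; rewrite -(perm_mem v12t) mem_cat lv2 orbT.
rewrite [leRHS]path_cost_rcons last_rcons !rcons_cat !path_cost_cat /=.
rewrite (path_cost_rev (last a v1)) revK !path_cost_rcons.
(* This product is exactly the gain of the reversal; it vanishes when [v2] is empty, since then
   [last q v2] is [q]. *)
have : 0 <= (last a v1 - b) * (last q v2 - q) by rewrite mulr_ge0 ?subr_ge0.
by lra.
Qed.

(** Reading the path backwards exchanges the two ends, so this is the mirror image of
    [min_to_right]. *)
Lemma min_to_left a b q t v :
    perm_eq v (q :: t) -> a <= b -> {in t, forall x, a <= x} ->
    {in t, forall x, q <= x} ->
  exists2 u, perm_eq u t &
    path_cost a (rcons v b) <= path_cost a (rcons (q :: u) b).
Proof.
move=> vqt ab at_ge qt.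
have rvqt : perm_eq (rev v) (q :: t) by rewrite perm_rev.
have [u ut le_u] := min_to_right rvqt ab at_ge qt.
exists (rev u); first by rewrite perm_rev.
by rewrite path_cost_rev [leRHS]path_cost_rev rev_cons revK.
Qed.

(** The greedy arrangement, built from the outside in: on an increasing list, the least remaining
    value goes to the right end and the next one to the left end. *)
Fixpoint alternate s : seq R :=
  if s is q1 :: s1 then
    if s1 is q2 :: t then q2 :: rcons (alternate t) q1 else [:: q1]
  else [::].

Lemma alternate_perm s : perm_eq (alternate s) s.
Proof.
elim/seq_pair_ind: s => //= q1 q2 t IH.
by rewrite -rcons_cons perm_rcons !perm_cons.
Qed.

(** Once [q1] is at the right, the new right end satisfies [a <= q1], so the left end is now the
    lower one and [q2] can go there. The remaining ends [q2] and [q1] satisfy [q1 <= q2], which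
    restores the hypothesis [b <= a] for the induction. *)
Lemma alternate_max s a b v :
    perm_eq v s -> pairwise <=%R s -> b <= a -> {in s, forall x, a <= x} ->
  path_cost a (rcons v b) <= path_cost a (rcons (alternate s) b).
Proof.
elim/seq_pair_ind: s a b v => [|q|q1 q2 t IH] a b v vs.
- by rewrite (perm_small_eq _ vs).
- by rewrite (perm_small_eq _ vs).
rewrite !pairwise_cons => /and3P[/allP q1_min /allP q2_min t_le] ba a_min.
have aq1 : a <= q1 by rewrite a_min ?mem_head.
have b_min : {in q2 :: t, forall x, b <= x}.
  by move=> x xt; rewrite (le_trans ba) ?a_min // inE xt orbT.
have [u ut le_u] := min_to_right vs ba b_min q1_min.
have a_min2 : {in t, forall x, a <= x}.
  by move=> x xt; rewrite a_min // !inE xt !orbT.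
have [u' u't le_u'] := min_to_left ut aq1 a_min2 q2_min.
apply: (le_trans le_u).
(* Both paths end with the edge from [q1] to [b], which cancels. *)
rewrite [leLHS]path_cost_rcons [leRHS]path_cost_rcons /= !last_rcons lerD2r.
apply: (le_trans le_u'); rewrite /= lerD2l.
by apply: IH => //; rewrite q1_min ?mem_head.
Qed.

(** Each value of [s] moved to the right becomes the new right end and is still at most [a], so the
    next minimum goes to the right as well. Only when [s] is exhausted does the alternation
    start. *)
Lemma voucher_max s t a b v :
    perm_eq v (s ++ t) -> pairwise <=%R (s ++ t) -> b <= a ->
    {in s ++ t, forall x, b <= x} ->
    {in s, forall x, x <= a} -> {in t, forall x, a <= x} ->
  path_cost a (rcons v b) <= path_cost a (rcons (alternate t ++ rev s) b).
Proof.
elim: s b v => [|q s IH] b v vst.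
  by rewrite cats0 => t_le ba _ _; exact: alternate_max.
rewrite cat_cons pairwise_cons => /andP[/allP q_min st_le] ba b_min s_max t_min.
have [x xst|u ust le_u] := min_to_right vst ba _ q_min.
  by rewrite b_min // inE xst orbT.
apply: (le_trans le_u).
rewrite rev_cons -rcons_cat [leLHS]path_cost_rcons [leRHS]path_cost_rcons.
rewrite !last_rcons lerD2r; apply: IH => //; first by rewrite s_max ?mem_head.
by move=> x xs; rewrite s_max // inE xs orbT.
Qed.

End PathCost.

(** Adding 2 preserves parity, so the word grows by one letter at each end, just as [alternate]
    does. *)
Lemma even_up_odd_down_step m :
  even_up_odd_down m.+2 = 2 :: rcons (map (addn 2) (even_up_odd_down m)) 1%N.
Proof.
have odd2 : preim (addn 2) odd =1 odd by move=> k /=; rewrite negbK.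
have even2 : preim (addn 2) (fun k => ~~ odd k) =1 (fun k => ~~ odd k).
  by move=> k /=; rewrite negbK.
rewrite /even_up_odd_down /= (iotaDl 2 1) !filter_map (eq_filter odd2).
by rewrite (eq_filter even2) map_cat map_rev rev_cons rcons_cat.
Qed.

Lemma even_up_odd_down_perm m : perm_eq (even_up_odd_down m) (iota 1 m).
Proof.
rewrite perm_sym -(perm_filterC odd) perm_catC perm_cat2l.
by rewrite perm_sym perm_rev.
Qed.

(** * The prescribed ordering as an explicit sequence *)

Section Prescribed.
Variable R : realType.
Implicit Types (s w : seq R) (A : {fset R}).

Lemma alternateE s :
  alternate s = [seq s`_k.-1 | k <- even_up_odd_down (size s)].
Proof.
elim/seq_pair_ind: s => // q1 q2 t IH.
rewrite [size _]/= even_up_odd_down_step map_cons map_rcons -map_comp /= IH.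
congr (_ :: rcons _ _).
(* The letters are at least 1; at [k = 0] the truncated predecessor would break the shift by two. *)
apply/eq_in_map => k; rewrite (perm_mem (even_up_odd_down_perm _)) mem_iota /=.
by case: k.
Qed.

Lemma order_isomorphic_alternate s w :
    sorted <%R s -> uniq w -> w =i s ->
  order_isomorphic w (even_up_odd_down (size s)) <-> w = alternate s.
Proof.
move=> s_lt w_uniq ws; set p := even_up_odd_down _.
have p_iota : perm_eq p (iota 1 (size s)) := even_up_odd_down_perm _.
have size_p : size p = size s by rewrite (perm_size p_iota) size_iota.
have p_uniq : uniq p by rewrite (perm_uniq p_iota) iota_uniq.
have mem_p k : (k \in p) = (0 < k <= size s)%N.
  by rewrite (perm_mem p_iota) mem_iota add1n ltnS.
have p_bound i : (i < size s)%N -> (0 < nth 0%N p i <= size s)%N.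
  by move=> lt_is; rewrite -mem_p mem_nth ?size_p.
have size_w : size w = size s.
  by apply/perm_size/uniq_perm => //; exact: lt_sorted_uniq.
have alt_nth i : (i < size s)%N -> (alternate s)`_i = s`_(nth 0%N p i).-1.
  by move=> lt_is; rewrite alternateE (nth_map 0%N) // size_p.
split=> [[_ iso]|->]; last first.
  have size_alt : size (alternate s) = size s by apply/perm_size/alternate_perm.
  split=> [|i j]; rewrite size_alt ?size_p // => lt_is lt_js.
  have := p_bound _ lt_is; have := p_bound _ lt_js.
  rewrite !alt_nth //.
  case: (nth 0%N p i) (nth 0%N p j) => [|k] [|l] //= lt_ls lt_ks.
  by rewrite (lt_sorted_ltn_nth 0 s_lt).
(* Reading [w] through the inverse of [p] lists its entries by rank, so [u] must be the increasing
   list [s]. *)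
pose u := [seq w`_(index k p) | k <- iota 1 (size s)].
have u_nth i : (i < size s)%N -> u`_i = w`_(index i.+1 p).
  by move=> lt_is; rewrite (nth_map 0%N) ?size_iota // nth_iota.
have index_lt i : (i < size s)%N -> (index i.+1 p < size w)%N.
  by move=> lt_is; rewrite size_w -size_p index_mem mem_p.
have u_lt : sorted <%R u.
  apply/(sortedP 0) => i; rewrite size_map size_iota => lt_is.
  have lt_is' := ltnW lt_is.
  by rewrite !u_nth // -iso ?index_lt // !nth_index ?mem_p.
have u_w : {subset u <= w}.
  move=> x /(nthP 0)[i]; rewrite size_map size_iota => lt_is <-.
  by rewrite u_nth // mem_nth ?index_lt.
have [|_ uw] := uniq_min_size (lt_sorted_uniq u_lt) u_w.
  by rewrite size_map size_iota size_w.
have us : u = s by apply: lt_sorted_eq => // x; rewrite uw ws.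
apply: (@eq_from_nth _ 0) => [|i lt_iw].
  by rewrite size_w; apply/esym/perm_size/alternate_perm.
rewrite size_w in lt_iw; have := p_bound _ lt_iw => /andP[p_gt0 p_le].
by rewrite alt_nth // -us u_nth ?prednK // index_uniq // size_p.
Qed.

Lemma sort_fset_lt A : sorted <%R (sort <=%R A).
Proof. by rewrite sort_lt_sorted fset_uniq. Qed.

(** This gives existence and uniqueness at once, and the right-hand side has the shape of the
    maximizer in [voucher_max]. *)
Lemma prescribed_orderingE A w :
  prescribed_ordering A w <->
  w = alternate (sort <=%R [fset x in A | 1 <= x])
      ++ rev (sort <=%R [fset x in A | x < 1]).
Proof.
rewrite /prescribed_ordering.
set big := [fset x in A | 1 <= x]; set small := [fset x in A | x < 1].
set t := sort _ big; set s := sort _ small.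
have t_lt : sorted <%R t := sort_fset_lt big.
have s_lt : sorted <%R s := sort_fset_lt small.
have mem_t : t =i big by move=> x; rewrite mem_sort.
have mem_s : s =i small by move=> x; rewrite mem_sort.
have -> : #|` big| = size t by rewrite size_sort.
split=> [[w1 [w2 [-> [w1_uniq w1E] iso [w2_uniq w2E] w2_gt]]]|->].
  congr (_ ++ _).
    by apply/order_isomorphic_alternate => // x; rewrite w1E mem_t.
  rewrite -[w2]revK; congr rev; apply: lt_sorted_eq => //.
    by rewrite rev_sorted.
  by move=> x; rewrite mem_rev w2E mem_s.
have alt_t := alternate_perm t.
have alt_uniq : uniq (alternate t).
  by rewrite (perm_uniq alt_t) lt_sorted_uniq.
exists (alternate t), (rev s); split=> //.
- by split=> // x; rewrite (perm_mem alt_t) mem_t.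
- by apply/order_isomorphic_alternate => //; exact: perm_mem.
- by split=> [|x]; rewrite ?rev_uniq ?lt_sorted_uniq // mem_rev mem_s.
- by rewrite rev_sorted.
Qed.

End Prescribed.

Theorem theorem11 (R : realType) (A : {fset R})
    (A_gt0 : forall x : R, x \in A -> 0 < x) :
  (exists! w : seq R, prescribed_ordering A w) /\
  (forall w : seq R, prescribed_ordering A w -> max_voucher_ordering A w).
Proof.
split.
  eexists; split=> [|w']; first by apply/prescribed_orderingE; reflexivity.
  by move/prescribed_orderingE.
move=> w /prescribed_orderingE->.
set t := sort _ _; set s := sort _ _.
have t_lt : sorted <%R t := sort_fset_lt _.
have s_lt : sorted <%R s := sort_fset_lt _.
have mem_t x : (x \in t) = (x \in A) && (1 <= x) by rewrite mem_sort !inE.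
have mem_s x : (x \in s) = (x \in A) && (x < 1) by rewrite mem_sort !inE.
have st_lt : pairwise <%R (s ++ t).
  rewrite pairwise_cat -!lt_sorted_pairwise s_lt t_lt !andbT.
  apply/allrelP => x y; rewrite mem_s mem_t => /andP[_ x1] /andP[_].
  exact: lt_le_trans.
have st_uniq : uniq (s ++ t) by rewrite lt_sorted_uniq ?lt_sorted_pairwise.
have st_A : s ++ t =i A.
  move=> x; rewrite mem_cat mem_s mem_t.
  by case: (ltP x 1); rewrite !(andbT, andbF, orbF).
have w_st : perm_eq (alternate t ++ rev s) (s ++ t).
  by rewrite perm_catC perm_cat ?perm_rev ?alternate_perm.
split; first by split=> [|x]; rewrite ?(perm_uniq w_st) // (perm_mem w_st).
(* The phantom ends are [a = 1] and [b = 0]: positivity keeps 0 below all values, and 1 separates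
   [s] from [t]. *)
move=> v [v_uniq vA]; rewrite !voucher_cost_path; apply: voucher_max => //.
- by apply: uniq_perm => // x; rewrite vA st_A.
- by apply: sub_pairwise st_lt => x y; exact: ltW.
- by move=> x; rewrite st_A => /A_gt0/ltW.
- by move=> x; rewrite mem_s => /andP[_ /ltW].
- by move=> x; rewrite mem_t => /andP[].
Qed.
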